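(* Let $\mathfrak{g}$ be a two-step nilpotent Lie group with the Campbell-Hausdorff multiplication $x\circ y=x+y+\frac12[x,y]$ (a real two-step nilpotent Lie algebra of dimension $d$ with basis $X_1,\dots,X_d$ and structure constants $a_{i,j,k}$, regarded also as a Lie group). For any Schwartz functions $f,g$ on $\mathfrak{g}$ and every multiindex $\alpha\in\mathbb{N}^d$, $$T^{\alpha}(f*g)=\sum_{\beta+\gamma+\sigma_{[0]}=\alpha}\binom{\alpha}{\beta}_{\sigma}\,c_{\sigma}\;T^{\beta+\sigma_{[1]}}f*T^{\gamma+\sigma_{[2]}}g,$$ where the sum runs over all $\beta,\gamma\in\mathbb{N}^d$ and $\sigma\in\mathbb{N}^D$ with $\beta+\gamma+\sigma_{[0]}=\alpha$, and the (nonzero) constants $c_\sigma$ are given by $$c_{\sigma}=2^{-\sum_{(i,j,k)\in D}\sigma_{(i,j,k)}}\prod_{(i,j,k)\in D}a_{i,j,k}^{\sigma_{(i,j,k)}},\qquad \sigma\in\mathbb{N}^D.$$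
   Context: $\mathbb{N}$ contains $0$. $\mathfrak{g}$ is a real two-step nilpotent Lie algebra of dimension $d$, endowed with dilations $(\delta_t)_{t>0}$ (one-parameter group of automorphisms) with exponents of homogeneity $1,2$, i.e. $\mathfrak{g}=\mathfrak{g}_1\oplus\mathfrak{g}_2$ with $\mathfrak{g}_j=\{x:\delta_t(x)=t^jx \text{ for all } t>0\}$. The vector space $\mathfrak{g}$ is also a Lie group with multiplication $x\circ y=x+y+\frac12[x,y]$ (so $y^{-1}=-y$). Fix a basis $X_1,\dots,X_d$ of $\mathfrak{g}$, write $x=\sum_i x_iX_i$, and define structure constants by $[X_i,X_j]=\sum_{k=1}^d a_{i,j,k}X_k$. A (normalized) Lebesgue measure $dx$ on $\mathfrak{g}$ is a Haar measure, and the convolution is $f*g(x)=\int_{\mathfrak{g}}f(x\circ y^{-1})g(y)\,dy$. For a multiindex $\alpha$, $T^\alpha f(x)=x^\alpha f(x)=x_1^{\alpha_1}\cdots x_d^{\alpha_d}f(x)$. Let $D=\{(i,j,k):a_{i,j,k}\neq0\}$. For $\sigma\in\mathbb{N}^D$ the multiindices $\sigma_{[0]},\sigma_{[1]},\sigma_{[2]}\in\mathbb{N}^d$ are $\sigma_{[0],k}=\sum_{i,j}\sigma_{(i,j,k)}$, $\sigma_{[1],i}=\sum_{j,k}\sigma_{(i,j,k)}$, $\sigma_{[2],j}=\sum_{i,k}\sigma_{(i,j,k)}$ (sums over triples in $D$). For $\alpha,\beta\in\mathbb{N}^d$, $\sigma\in\mathbb{N}^D$ with $\beta+\sigma_{[0]}\le\alpha$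 (componentwise), $$\binom{\alpha}{\beta}_\sigma=\frac{\alpha!}{\beta!\,\sigma!\,(\alpha-\beta-\sigma_{[0]})!},$$ where factorials of multiindices are products of the factorials of their entries. *)

(* Defs.v *)
From HB Require Import structures.
From mathcomp Require Import all_boot all_order all_algebra.
From mathcomp Require Import complex.
From mathcomp Require Import all_classical all_reals all_analysis.

Set Implicit Arguments.
Unset Strict Implicit.
Unset Printing Implicit Defensive.

Import Order.TTheory GRing.Theory Num.Theory.
Import numFieldNormedType.Exports.

Local Open Scope classical_set_scope.
Local Open Scope ring_scope.

(** * Lebesgue measure on R^n *)

Section TupleConsMeasure.
Context {R : realType} (n : nat).
Variable mu : {sigma_finite_measure set (n.-tuple (measurableTypeR R)) -> \bar R}.
Local Notation T := (measurableTypeR R).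

Definition tuple_cons (p : T * n.-tuple T) : n.+1.-tuple T := cons_tuple p.1 p.2.

Definition tuple_uncons (t : n.+1.-tuple T) : T * n.-tuple T :=
  (tnth t ord0, behead_tuple t).

Lemma tuple_consK : cancel tuple_cons tuple_uncons.
Proof.
case=> x t; rewrite /tuple_cons /tuple_uncons /=; congr (_, _).
exact: val_inj.
Qed.

Lemma tuple_unconsK : cancel tuple_uncons tuple_cons.
Proof.
by move=> t; apply: val_inj; case/tupleP: t => x t.
Qed.

Lemma measurable_tuple_cons : measurable_fun setT tuple_cons.
Proof. exact: measurable_cons. Qed.

Lemma measurable_tuple_uncons : measurable_fun setT tuple_uncons.
Proof.
apply/measurable_fun_pair; first exact: measurable_tnth.
exact: measurable_behead.
Qed.

Definition tuple_cons_measure : set (n.+1.-tuple T) -> \bar R :=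
  pushforward (lebesgue_measure \x mu)%E tuple_cons.

Let tuple_cons_measure0 : tuple_cons_measure set0 = 0%E.
Proof. by rewrite /tuple_cons_measure /pushforward preimage_set0 measure0. Qed.

Let tuple_cons_measure_ge0 A : (0 <= tuple_cons_measure A)%E.
Proof. by rewrite /tuple_cons_measure /pushforward measure_ge0. Qed.

Let tuple_cons_measure_sigma_additive : semi_sigma_additive tuple_cons_measure.
Proof.
pose f : {mfun (T * n.-tuple T)%type >-> n.+1.-tuple T} :=
  mfun_Sub (mem_set measurable_tuple_cons).
exact: (@measure_semi_sigma_additive _ _ _ (pushforward (lebesgue_measure \x mu)%E f)).
Qed.

HB.instance Definition _ := isMeasure.Build _ _ _ tuple_cons_measure
  tuple_cons_measure0 tuple_cons_measure_ge0 tuple_cons_measure_sigma_additive.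

Let tuple_cons_measure_sigma_finite : sigma_finite setT tuple_cons_measure.
Proof.
have /sigma_finiteP[F [TF ndF Foo]] := sigma_finiteT (@lebesgue_measure R).
have /sigma_finiteP[G [TG ndG Goo]] := sigma_finiteT mu.
exists (fun k => tuple_uncons @^-1` (F k `*` G k)).
  rewrite -preimage_bigcup (_ : \bigcup_i _ = setT) ?preimage_setT//.
  apply/seteqP; split => // -[x t] _.
  have [i _ Fi] : (\bigcup_i F i) x by rewrite -TF.
  have [j _ Gj] : (\bigcup_i G i) t by rewrite -TG.
  exists (maxn i j) => //; split => /=.
    exact: (subsetPset _ _ (ndF _ _ (leq_maxl i j))).
  exact: (subsetPset _ _ (ndG _ _ (leq_maxr i j))).
move=> k; have [mF Fk] := Foo k; have [mG Gk] := Goo k; split.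
  rewrite -[X in measurable X]setTI; apply: measurable_tuple_uncons => //.
  exact: measurableX.
rewrite /tuple_cons_measure /pushforward -comp_preimage.
rewrite (_ : _ \o _ = id); last by apply/funext => p /=; exact: tuple_consK.
by rewrite preimage_id product_measure1E// lte_mul_pinfty// ge0_fin_numE.
Qed.

HB.instance Definition _ := Measure_isSigmaFinite.Build _ _ _
  tuple_cons_measure tuple_cons_measure_sigma_finite.

End TupleConsMeasure.

Fixpoint lebesgue_tuple (R : realType) (n : nat) :
    {sigma_finite_measure set (n.-tuple (measurableTypeR R)) -> \bar R} :=
  match n with
  | 0 => \d_ [tuple]
  | n'.+1 => tuple_cons_measure (lebesgue_tuple R n')
  end.

Lemma lebesgue_tuple_box (R : realType) (n : nat)
    (A : 'I_n -> set (measurableTypeR R)) :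
  (forall i, measurable (A i)) ->
  lebesgue_tuple R n [set t | forall i, A i (tnth t i)] =
  (\prod_(i < n) lebesgue_measure (A i))%E.
Proof.
elim: n A => [|n IHn] A mA /=.
  by rewrite big_ord0 diracE mem_set//= => -[].
rewrite big_ord_recl -IHn//= /tuple_cons_measure /pushforward -product_measure1E//.
  congr ((_ \x _)%E _); apply/seteqP; split => -[x t] /=.
    by move=> At; split => [|i] /=; [have := At ord0 | have := At (lift ord0 i); rewrite tnthS].
  by move=> [Ax At] i; have [j ->|->] := unliftP ord0 i; rewrite ?tnthS.
rewrite (_ : [set _ | _] = \bigcap_(i in [set: 'I_n]) ((@tnth _ _ ^~ i) @^-1` A (lift ord0 i))).
  apply: fin_bigcap_measurable => // i _.
  by rewrite -[X in measurable X]setTI; exact: measurable_tnth.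
by apply/seteqP; split => t /= At i => [_|]; exact: At.
Qed.

(** * Graded two-step Lie algebras *)

Section LieAlgebra.
Context {R : realType} {g : vectType R}.
Variable br : {bilinear g -> g -> g}.

Record lie_bracket : Prop := LieBracket {
  lie_alternating : forall x, br x x = 0;
  lie_jacobi : forall x y z, br x (br y z) + br y (br z x) + br z (br x y) = 0
}.

(** Nilpotent of step at most two; the abelian case is not excluded. *)
Definition two_step : Prop := forall x y z, br (br x y) z = 0.

(** Only the values [delta t] with [0 < t] are meaningful. *)
Record dilations (delta : R -> 'End(g)) : Prop := Dilations {
  dilation1 : delta 1 = \1%VF;
  dilationM : forall s t, 0 < s -> 0 < t -> delta (s * t) = (delta s \o delta t)%VF;
  dilation_br : forall t x y, 0 < t -> delta t (br x y) = br (delta t x) (delta t y)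
}.

Definition homogeneous_part (delta : R -> 'End(g)) (j : nat) : set g :=
  [set x | forall t, 0 < t -> delta t x = t ^+ j *: x].

Definition graded12 (delta : R -> 'End(g)) : Prop :=
  exists g1 g2 : {vspace g},
    [/\ [set` g1] = homogeneous_part delta 1,
        [set` g2] = homogeneous_part delta 2,
        (g1 + g2)%VS = fullv & directv (g1 + g2)].

Definition lie_mul (x y : g) : g := x + y + 2^-1 *: br x y.

Definition lie_inv (x : g) : g := - x.

Definition struct_const d (X : d.-tuple g) (t : 'I_d * 'I_d * 'I_d) : R :=
  coord X t.2 (br (tnth X t.1.1) (tnth X t.1.2)).

(** The index set [D] of the nonzero structure constants [a_(i, j, k)], a triple
    being encoded as [((i, j), k)]. *)
Definition struct_dom d (X : d.-tuple g) : finType :=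
  {t : 'I_d * 'I_d * 'I_d | struct_const X t != 0}.

End LieAlgebra.

(** * Multiindices *)

Notation multiindex I := {ffun I -> nat}.

Definition mfact (I : finType) (a : multiindex I) : nat := (\prod_i (a i)`!)%N.

Section Sigma.
Context {R : realType} {g : vectType R} (br : {bilinear g -> g -> g}).
Context {d : nat} (X : d.-tuple g).
Implicit Types (a b c : multiindex 'I_d) (s : multiindex (struct_dom br X)).

Definition sigma0 s : multiindex 'I_d :=
  [ffun k => (\sum_(t : struct_dom br X | (val t).2 == k) s t)%N].

Definition sigma1 s : multiindex 'I_d :=
  [ffun i => (\sum_(t : struct_dom br X | (val t).1.1 == i) s t)%N].

Definition sigma2 s : multiindex 'I_d :=
  [ffun j => (\sum_(t : struct_dom br X | (val t).1.2 == j) s t)%N].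

(** Intended for [b + sigma0 s <= a]; the subtraction is truncated otherwise. *)
Definition sigma_binom a b s : R :=
  (mfact a)%:R /
  (mfact b * mfact s * mfact [ffun k => (a k - b k - sigma0 s k)%N])%N%:R.

Definition sigma_const s : R :=
  2 ^- (\sum_t s t)%N * \prod_t struct_const br X (val t) ^+ s t.

Definition sigma_decomp a :
    set (multiindex 'I_d * multiindex 'I_d * multiindex (struct_dom br X)) :=
  [set u | u.1.1 + u.1.2 + sigma0 u.2 = a].

(** [\sum_(u \in A) F u] is [0] by convention when the support is infinite. *)
Lemma finite_sigma_decomp a : finite_set (sigma_decomp a).
Proof.
pose N := (\sum_k a k)%N.
pose B (I : finType) := {ffun I -> 'I_N.+1}.
pose unB (I : finType) (w : B I) : multiindex I := [ffun i => w i : nat].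
pose F (w : B 'I_d * B 'I_d * B (struct_dom br X)) :=
  (unB _ w.1.1, unB _ w.1.2, unB _ w.2).
have unBK (I : finType) (w : multiindex I) : (forall i, w i <= N)%N ->
    unB I [ffun i => inord (w i)] = w.
  by move=> wN; apply/ffunP => i; rewrite !ffunE inordK ?ltnS.
have aN k : (a k <= N)%N by rewrite /N (bigD1 k)//= leq_addr.
apply: (@sub_finite_set _ _ (F @` setT)); last exact/finite_image/finite_finset.
move=> [[b c] s]; rewrite /sigma_decomp /= => E.
have Ek k : (b k + c k + sigma0 s k)%N = a k by rewrite -E !ffunE.
have bN k : (b k <= N)%N by rewrite (leq_trans _ (aN k))// -Ek -addnA leq_addr.
have cN k : (c k <= N)%N.
  by rewrite (leq_trans _ (aN k))// -Ek addnAC leq_addl.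
have sN t : (s t <= N)%N.
  apply: leq_trans (aN (val t).2); rewrite -Ek ffunE (bigD1 t)//=.
  by rewrite addnA addnAC leq_addl.
exists ([ffun i => inord (b i)], [ffun i => inord (c i)], [ffun t => inord (s t)]) => //.
by rewrite /F /= !unBK.
Qed.

End Sigma.

Arguments sigma_decomp {R g} br {d} X a.

(** * Schwartz functions and convolution in the coordinates of a basis *)

Section Analysis.
Context {R : realType} {d : nat}.

Definition partial (F : 'rV[R]_d -> R) (i : 'I_d) : 'rV[R]_d -> R :=
  fun v => 'D_(delta_mx 0 i) F v.

(** Mixed partial derivatives are indexed by the sequence of directions, so that
    no symmetry of higher derivatives is presupposed. *)
Definition iter_partial (s : seq 'I_d) (F : 'rV[R]_d -> R) : 'rV[R]_d -> R :=
  foldr (fun i G => partial G i) F s.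

Definition smooth_rV (F : 'rV[R]_d -> R) : Prop :=
  forall s, continuous (iter_partial s F) /\
    forall v i, derivable (iter_partial s F) v (delta_mx 0 i).

Definition schwartz_rV (F : 'rV[R]_d -> R) : Prop :=
  smooth_rV F /\
  forall (a : multiindex 'I_d) (s : seq 'I_d), exists M : R, forall v : 'rV[R]_d,
    `|\prod_i v 0 i ^+ a i * iter_partial s F v| <= M.

Context {g : vectType R} (X : d.-tuple g).

Definition of_coords (v : 'I_d -> R) : g := \sum_i v i *: tnth X i.

(** [R[i]] has no normed module structure over [R] here, hence the separate
    treatment of real and imaginary parts; a function on [g] is read as a
    function on [R^d] through the coordinates of the basis [X]. *)
Definition schwartz (f : g -> R[i]) : Prop :=
  schwartz_rV (fun v : 'rV[R]_d => complex.Re (f (of_coords (v 0)))) /\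
  schwartz_rV (fun v : 'rV[R]_d => complex.Im (f (of_coords (v 0)))).

Definition monomial (a : multiindex 'I_d) (x : g) : R :=
  \prod_i coord X i x ^+ a i.

Definition Tmul (a : multiindex 'I_d) (f : g -> R[i]) : g -> R[i] :=
  fun x => (monomial a x)%:C%C * f x.

(** The constant [c] is the measure of the unit cube of the basis [X]. *)
Definition lie_integral (c : {posnum R}) (f : g -> R[i]) : R[i] :=
  let mu := mscale c%:num%:nng (lebesgue_tuple R d) in
  Complex (\int[mu]_t complex.Re (f (of_coords (tnth t))))
          (\int[mu]_t complex.Im (f (of_coords (tnth t)))).

Definition lie_conv (br : {bilinear g -> g -> g}) (c : {posnum R})
    (f h : g -> R[i]) : g -> R[i] :=
  fun x => lie_integral c (fun y => f (lie_mul br x (lie_inv y)) * h y).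

End Analysis.

(* Main.v *)
Require Import Defs.
From mathcomp Require Import all_boot all_order all_algebra.
From mathcomp Require Import complex.
From mathcomp Require Import all_classical all_reals all_analysis.
From mathcomp Require Import measurable_realfun ring.

(** Put [z = x o y^-1], so that [x = z o y] and the integrand of [f * g] at [x] is
    [f z * g y].  In coordinates the group law reads
    [x_k = z_k + y_k + sum_t 2^-1 * a_t * z_i * y_j], the sum running over the
    [t = (i, j, k)] in [D] with third entry [k].  Hence [x^alpha] is a product of
    powers of sums, and the multinomial theorem turns it into a combination of
    the [z^(beta + sigma1) * y^(gamma + sigma2)] whose coefficients are those of
    the theorem ([monomial_lie_mul]).  For fixed [x] this is an identity between
    polynomials in [y]; multiplying it by [f z * g y] and integrating term by
    term gives the formula.

    The multinomial theorem is needed in a form with several exponents: the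
    monomials [z_k], [y_k], [a_t z_i y_j] are distributed over the coordinates [k]
    by a map [p], and one expands [prod_k (sum_(p j = k) w_j)^(alpha_k)].  With
    divided powers [w^m / m!] it reads [divided_power_sum]: the divided powers of
    the fibre sums are the sums, over the multiindices [m] with image [alpha], of
    the divided powers of [w].

    Integrating term by term requires each term to be integrable
    ([lie_integrable_conv]).  A polynomial weight times a Schwartz function of [z]
    is bounded, and a polynomial weight times a Schwartz function of [y] is
    dominated by a multiple of [prod_i (1 + y_i^2)^-1], whose integral factors into
    one-dimensional arctangent integrals.  Measurability of the integrand comes
    from a general fact: composing a continuous function on [R^n] with a map whose
    coordinates are measurable gives a measurable function. *)

Set Implicit Arguments.
Unset Strict Implicit.
Unset Printing Implicit Defensive.

Import Order.TTheory GRing.Theory Num.Theory.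
Import numFieldNormedType.Exports.

Local Open Scope classical_set_scope.
Local Open Scope ring_scope.

(** * Multinomial expansion of a product of fibre sums *)

Definition munit (K : finType) (k : K) : multiindex K := [ffun l => (l == k) : nat].

Lemma munitDE (K : finType) (k l : K) (m : multiindex K) :
  (m + munit k) l = (m l + (l == k))%N.
Proof. by rewrite !ffunE. Qed.

Lemma munitDK (K : finType) (k : K) (m : multiindex K) :
  (0 < m k)%N -> [ffun l => (m l - (l == k))%N] + munit k = m.
Proof.
move=> mk; apply/ffunP => l; rewrite munitDE ffunE.
by have [->|_] := eqVneq l k; [rewrite subnK | rewrite subn0 addn0].
Qed.

Lemma munitD_inj (K : finType) (k : K) : injective (fun m : multiindex K => m + munit k).
Proof.
by move=> m1 m2 /ffunP E; apply/ffunP => l; have := E l; rewrite !munitDE; exact: addIn.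
Qed.

Definition divided_power (F : numFieldType) (J : finType) (w : J -> F)
    (m : multiindex J) : F :=
  \prod_j (w j ^+ m j / (m j)`!%:R).

(** Dividing by the factorials turns multiplication by [w j] into a shift of the
    [j]-th exponent whose only coefficient is the new exponent, so no binomial
    coefficients enter the induction below. *)
Lemma divided_power_munitD (F : numFieldType) (J : finType) (w : J -> F) (j : J)
    (m : multiindex J) :
  (m j).+1%:R * divided_power w (m + munit j) = w j * divided_power w m.
Proof.
rewrite /divided_power (bigD1 j)//= [in RHS](bigD1 j)//= !mulrA; congr (_ * _).
  rewrite munitDE eqxx addn1 exprS factS natrM invfM.
  by rewrite mulrCA -!mulrA mulKf ?pnatr_eq0// mulrC mulrA.
by apply: eq_bigr => k kj; rewrite munitDE (negbTE kj) addn0.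
Qed.

Section DividedPowers.
Variables (F : numFieldType) (I J : finType) (p : J -> I).

Definition push_multiindex (m : multiindex J) : multiindex I :=
  [ffun i => (\sum_(j | p j == i) m j)%N].

Lemma finite_push_fiber (a : multiindex I) :
  finite_set [set m | push_multiindex m = a].
Proof.
pose N := (\sum_i a i)%N.
pose unB (w : {ffun J -> 'I_N.+1}) : multiindex J := [ffun j => w j : nat].
apply: (@sub_finite_set _ _ (unB @` setT)); last exact/finite_image/finite_finset.
move=> m /= pm; exists [ffun j => inord (m j)] => //.
apply/ffunP => j; rewrite !ffunE inordK// ltnS /N (bigD1 (p j))//= -pm ffunE.
by rewrite (bigD1 j)//= -addnA leq_addr.
Qed.

Lemma push_munitD (j : J) (m : multiindex J) :
  push_multiindex (m + munit j) = push_multiindex m + munit (p j).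
Proof.
apply/ffunP => i; rewrite munitDE !ffunE.
under eq_bigr do rewrite munitDE.
rewrite big_split /=; congr addn.
have [->|ij] := eqVneq i (p j).
  by rewrite (bigD1 j)//= eqxx big1 ?addn0// => k /andP[_ /negbTE->].
rewrite big1// => k /eqP pk; apply/eqP; rewrite eqb0.
by apply: contra ij => /eqP <-; rewrite pk.
Qed.

(** Counting with multiplicity: [a i + 1] is the total exponent that a multiindex
    [m] over [a + munit i] puts on the fibre of [i].  Spreading this factor over
    the [j] in the fibre leaves only terms with [m j > 0], which are the
    [m' + munit j] with [m'] over [a].  This is the recursion that both sides of
    [divided_power_sum] satisfy. *)
Lemma sum_divided_power_munitD (w : J -> F) (i : I) (a : multiindex I) :
  (a i).+1%:R * \sum_(m \in [set m | push_multiindex m = a + munit i]) divided_power w m =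
  (\sum_(j | p j == i) w j) *
    \sum_(m \in [set m | push_multiindex m = a]) divided_power w m.
Proof.
set A := [set m | _ = a + _]; set B := [set m | _ = a].
have fA : finite_set A by exact: finite_push_fiber.
have fB : finite_set B by exact: finite_push_fiber.
rewrite mulr_fsumr mulr_suml.
transitivity (\sum_(m \in A) \sum_(j | p j == i) (m j)%:R * divided_power w m).
  apply: eq_fsbigr => m; rewrite inE /A /= => pm; rewrite -mulr_suml; congr (_ * _).
  by rewrite -natr_sum; move/ffunP/(_ i): pm; rewrite munitDE ffunE eqxx addn1 => ->.
rewrite fsbig_finite// exchange_big/=; apply: eq_bigr => j /eqP pj.
rewrite -fsbig_finite// mulr_fsumr.
(* The factor [m j] kills the terms outside the range of [m |-> m + munit j]. *)
rewrite -(@fsbig_widen _ _ _ _ (A `&` [set m | (0 < m j)%N])); last first.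
- move=> m [] Am /not_andP[]//= /negP; rewrite -eqn0Ngt => /eqP ->.
  by rewrite mul0r.
- by move=> m [].
rewrite (@reindex_fsbig _ _ _ _ _ (fun m => m + munit j) B).
  apply: eq_fsbigr => m _; rewrite -divided_power_munitD; congr (_ * _).
  by rewrite munitDE eqxx addn1.
split.
- move=> m /=; rewrite /A /B /= => pm; split; first by rewrite push_munitD pm pj.
  by rewrite munitDE eqxx addn1.
- by move=> m1 m2 _ _; exact: munitD_inj.
- move=> m [/= pm mj]; have Em := munitDK mj.
  eexists; last exact: Em.
  by apply/(@munitD_inj _ i); rewrite -pj -push_munitD Em pm pj.
Qed.

(** The multinomial theorem with one exponent for each fibre of [p].  Induction on
    the total degree replaces the usual bookkeeping of products of sums: both sides
    are [1] at [0] and obey the same recursion in each coordinate. *)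
Lemma divided_power_sum (w : J -> F) (a : multiindex I) :
  \prod_i ((\sum_(j | p j == i) w j) ^+ a i / (a i)`!%:R) =
  \sum_(m \in [set m | push_multiindex m = a]) divided_power w m.
Proof.
have [n] := ubnP (\sum_i a i)%N; elim: n a => // n IH a an.
have [/eqP a0|] := boolP (a == 0).
  rewrite big1; last by move=> i _; rewrite a0 !ffunE expr0 invr1 mulr1.
  rewrite (_ : [set m | _] = [set 0]) ?fsbig_set1.
    by rewrite /divided_power big1// => j _; rewrite ffunE expr0 invr1 mulr1.
  apply/seteqP; split => m /=.
    rewrite a0 => pm; apply/ffunP => j; rewrite ffunE; apply/eqP.
    move/ffunP/(_ (p j)) : pm; rewrite !ffunE => /eqP; rewrite sum_nat_eq0.
    by move/forallP/(_ j); rewrite eqxx.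
  by move=> ->; rewrite a0; apply/ffunP => i; rewrite !ffunE big1// => j _; rewrite ffunE.
move=> /eqP a0; have [i ai] : exists i, (0 < a i)%N.
  apply: contrapT => /forallNP H; apply: a0; apply/ffunP => i.
  by rewrite ffunE; have /negP := H i; rewrite -eqn0Ngt => /eqP.
have [b ab] : exists b, a = b + munit i by
  exists [ffun l => (a l - (l == i))%N]; exact/esym/munitDK.
have bn : (\sum_i b i < n)%N.
  have u1 : (\sum_k (k == i) = 1)%N.
    by rewrite (bigD1 i)//= eqxx big1// => k /negbTE ->.
  move: an; rewrite ab ltnS; under eq_bigr do rewrite munitDE.
  by rewrite big_split/= u1 addn1.
have bi0 : (b i).+1%:R != 0 :> F by rewrite pnatr_eq0.
apply: (mulfI bi0); rewrite ab sum_divided_power_munitD -IH//.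
exact: (divided_power_munitD (fun i => \sum_(j | p j == i) w j)).
Qed.

End DividedPowers.

(** * The group law in coordinates *)

Section Coordinates.
Context {R : realType} {g : vectType R} {d : nat} (X : d.-tuple g).
Hypothesis hX : basis_of fullv X.

Lemma coordK (x : g) : of_coords X (fun i => coord X i x) = x.
Proof.
rewrite /of_coords [RHS](coord_basis hX (memvf x)).
by apply: eq_bigr => i _; rewrite -tnth_nth.
Qed.

Lemma of_coordsK (v : 'I_d -> R) (i : 'I_d) : coord X i (of_coords X v) = v i.
Proof.
rewrite /of_coords -[RHS](coord_sum_free v i (basis_free hX)).
by congr (coord X i _); apply: eq_bigr => j _; rewrite -tnth_nth.
Qed.

Lemma monomialD (a b : multiindex 'I_d) (x : g) :
  monomial X (a + b) x = monomial X a x * monomial X b x.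
Proof.
rewrite /monomial -big_split/=; apply: eq_bigr => i _.
by rewrite -exprD !ffunE.
Qed.

Variable br : {bilinear g -> g -> g}.

(** Substituting [z = x o y^-1] produces the double bracket [br (br x y) y], which
    vanishes because the algebra is two-step nilpotent. *)
Lemma lie_mul_invK (x y : g) : lie_bracket br -> two_step br ->
  lie_mul br (lie_mul br x (lie_inv y)) y = x.
Proof.
move=> [alt _] step; rewrite /lie_mul /lie_inv linearNr scalerN.
rewrite linearDl linearBl linearNl linearZl_LR step scaler0 oppr0 alt subr0 addr0.
by rewrite addrAC subrK subrK.
Qed.

Lemma coord_br (z y : g) (k : 'I_d) :
  coord X k (br z y) =
  \sum_(t : struct_dom br X | (val t).2 == k)
     struct_const br X (val t) * (coord X (val t).1.1 z * coord X (val t).1.2 y).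
Proof.
pose G (t : 'I_d * 'I_d * 'I_d) :=
  struct_const br X t * (coord X t.1.1 z * coord X t.1.2 y).
rewrite -(big_sub_cond (fun t => struct_const br X t != 0) (fun t => t.2 == k) G).
transitivity (\sum_(t : 'I_d * 'I_d * 'I_d | t.2 == k) G t); last first.
  rewrite big_mkcond [RHS]big_mkcond; apply: eq_bigr => t _.
  rewrite unfold_in; have [s0|_] := eqVneq (struct_const br X t) 0; last by [].
  by rewrite /G s0 mul0r; case: ifP.
rewrite -(pair_big xpredT (fun k' => k' == k) (fun p k' => G (p, k')))/=.
under [RHS]eq_bigr => p _ do rewrite big_pred1_eq.
rewrite -(pair_big xpredT xpredT (fun i j => G ((i, j), k)))/=.
rewrite -{1}(coordK z) -{1}(coordK y) /of_coords linear_sumlz linear_sum.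
apply: eq_bigr => i _; rewrite linear_sumr linear_sum; apply: eq_bigr => j _.
by rewrite linearZl_LR linearZr_LR !linearZ /= /G /struct_const /= mulrA mulrC.
Qed.

(** The pointwise form of the theorem.  The summands of all the coordinates of
    [z o y] are indexed by the disjoint union of two copies of the coordinates, for
    the [z_k] and the [y_k], and of [D]; the map [p] sends a summand to its
    coordinate.  A multiindex on this union is a triple [(beta, gamma, sigma)], and
    its image under [p] is [beta + gamma + sigma0 sigma]. *)
Lemma monomial_lie_mul (z y : g) (alpha : multiindex 'I_d) :
  monomial X alpha (lie_mul br z y) =
  \sum_(u \in sigma_decomp br X alpha)
    (sigma_binom alpha u.1.1 u.2 * sigma_const u.2) *
    (monomial X (u.1.1 + sigma1 u.2) z * monomial X (u.1.2 + sigma2 u.2) y).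
Proof.
pose J : finType := ('I_d + 'I_d + struct_dom br X)%type.
pose p (j : J) : 'I_d := match j with
  | inl (inl i) => i | inl (inr i) => i | inr t => (val t).2 end.
pose w (j : J) : R := match j with
  | inl (inl i) => coord X i z | inl (inr i) => coord X i y
  | inr t => 2^-1 * struct_const br X (val t) *
      (coord X (val t).1.1 z * coord X (val t).1.2 y) end.
pose h (u : multiindex 'I_d * multiindex 'I_d * multiindex (struct_dom br X)) :
  multiindex J := [ffun j : J => match j with
  | inl (inl i) => u.1.1 i | inl (inr i) => u.1.2 i | inr t => u.2 t end].
have pE k : \sum_(j | p j == k) w j = coord X k (lie_mul br z y).
  rewrite !big_sumType/= !big_pred1_eq /lie_mul !linearD linearZ/= coord_br mulr_sumr.
  by congr (_ + _); apply: eq_bigr => t _; rewrite -mulrA.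
have hE u : push_multiindex p (h u) = u.1.1 + u.1.2 + sigma0 u.2.
  apply/ffunP => k; rewrite !ffunE !big_sumType/=.
  under eq_bigr do rewrite ffunE; under [X in (_ + X + _)%N]eq_bigr do rewrite ffunE.
  by under [X in (_ + X)%N]eq_bigr do rewrite ffunE; rewrite !big_pred1_eq.  
have fact0 (I : finType) (m : multiindex I) : (mfact m)%:R != 0 :> R.
  by rewrite pnatr_eq0 -lt0n prodn_gt0// => i; exact: fact_gt0.
transitivity ((mfact alpha)%:R *
    \prod_k ((\sum_(j | p j == k) w j) ^+ alpha k / (alpha k)`!%:R)).
  rewrite prodf_div -natr_prod -/(mfact alpha) mulrC divfK//.
  by apply: eq_bigr => k _; rewrite pE.
rewrite divided_power_sum mulr_fsumr.
rewrite (@reindex_fsbig _ _ _ _ _ h (sigma_decomp br X alpha)); last first.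
  split.
  - by move=> u /= ua; rewrite hE.
  - move=> u u' _ _ /ffunP E; case: u u' E => [[b c] s] [[b' c'] s'] E.
    congr (_, _, _); apply/ffunP => i.
    + by have := E (inl (inl i)); rewrite !ffunE.
    + by have := E (inl (inr i)); rewrite !ffunE.
    + by have := E (inr i); rewrite !ffunE.
  - move=> m /= ma; pose u := ([ffun i => m (inl (inl i))] : multiindex 'I_d,
      [ffun i => m (inl (inr i))] : multiindex 'I_d,
      [ffun t => m (inr t)] : multiindex (struct_dom br X)).
    have hu : h u = m by apply/ffunP => -[[i|i]|t]; rewrite !ffunE.
    by exists u => //; have := hE u; rewrite hu ma => /esym.
apply: eq_fsbigr => -[[b c] s]; rewrite inE /sigma_decomp /= => ua.
have cE : [ffun k => (alpha k - b k - sigma0 s k)%N] = c.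
  apply/ffunP => k; rewrite ffunE.
  have -> : alpha k = (b k + c k + sigma0 s k)%N by rewrite -ua !ffunE.
  by rewrite -addnA addKn addnK.
have zs : \prod_t coord X (val t).1.1 z ^+ s t = monomial X (sigma1 s) z.
  rewrite (partition_big (fun t : struct_dom br X => (val t).1.1) xpredT)//=.
  apply: eq_bigr => i _; rewrite ffunE -prodrXr.
  by apply: eq_bigr => t /eqP <-.
have ys : \prod_t coord X (val t).1.2 y ^+ s t = monomial X (sigma2 s) y.
  rewrite (partition_big (fun t : struct_dom br X => (val t).1.2) xpredT)//=.
  apply: eq_bigr => i _; rewrite ffunE -prodrXr.
  by apply: eq_bigr => t /eqP <-.
have -> : divided_power w (h (b, c, s)) =
    (monomial X b z / (mfact b)%:R) * (monomial X c y / (mfact c)%:R) *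
    (sigma_const s * (monomial X (sigma1 s) z * monomial X (sigma2 s) y) / (mfact s)%:R).
  rewrite /divided_power !big_sumType/=; congr (_ * _ * _).
  - by rewrite natr_prod -prodf_div; apply: eq_bigr => i _; rewrite ffunE.
  - by rewrite natr_prod -prodf_div; apply: eq_bigr => i _; rewrite ffunE.
  - rewrite -zs -ys /sigma_const -exprVn -prodrXr -!big_split/= natr_prod -prodf_div.
    by apply: eq_bigr => t _; rewrite ffunE /= !exprMn.
rewrite /sigma_binom cE !monomialD !natrM /=.
by field; rewrite !fact0.
Qed.
End Coordinates.

(** * Measurability of continuous functions of measurable coordinates *)

Section Measurability.
Context {R : realType}.

(** An open subset of [R^n] is the union of the rational cubes that it contains;
    there are countably many of them, and the preimage of a cube is a finite
    intersection of preimages of intervals by the coordinates. *)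
Lemma continuous_measurable_rV d (T : measurableType d) (n : nat)
    (F : 'rV[R]_n -> R) (phi : T -> 'rV[R]_n) :
  continuous F -> (forall i, measurable_fun setT (fun t => phi t 0 i)) ->
  measurable_fun setT (F \o phi).
Proof.
move=> /continuousP cF mphi.
apply: (measurability _ (RGenOpens.measurableE R)) => _ [_ [a [b ->]] <-].
rewrite setTI.
set U := F @^-1` `]a, b[%classic.
have oU : open U by apply: cF; exact: interval_open.
pose E (q : 'rV[rat]_n) (k : nat) : set T :=
  [set t | forall i, @ball R R (ratr (q 0 i)) k.+1%:R^-1 (phi t 0 i)].
pose G (u : 'rV[rat]_n * nat) : set T :=
  [set t | E u.1 u.2 t /\ E u.1 u.2 `<=` phi @^-1` U].
have mE q k : measurable (E q k).
  rewrite (_ : E q k = \bigcap_(i in [set: 'I_n])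
     ((fun t => phi t 0 i) @^-1` @ball R R (ratr (q 0 i)) k.+1%:R^-1)).
    apply: fin_bigcap_measurable => // i _; rewrite -[X in measurable X]setTI.
    by apply: mphi => //; apply: open_measurable; exact: ball_open.
  by apply/seteqP; split => t /= Et i => [_|]; exact: Et.
(* [G u] is the preimage of the cube [u] if that preimage lies over [U], and is
   empty otherwise. *)
rewrite (_ : _ @^-1` _ = \bigcup_u G u).
  apply: countable_bigcupT_measurable => // u.
  have [EU|EU] := pselect (E u.1 u.2 `<=` phi @^-1` U).
    by rewrite (_ : G u = E u.1 u.2)//; apply/seteqP; split => t // [].
  by rewrite (_ : G u = set0)//; apply/seteqP; split => t // [].
apply/seteqP; split => t; last by move=> [u _ [Et]]; exact.
move=> Ut; have : nbhs (phi t) U by apply: open_nbhs_nbhs; split.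
move=> /nbhs_ballP[e /= e0 eU].
(* A rational cube of half-width below [e / 2] that contains [phi t] lies in the
   ball of radius [e] around [phi t]. *)
have [k ke] : exists k, k.+1%:R^-1 < e / 2.
  have e20 : 0 < e / 2 by rewrite divr_gt0.
  have [k _ /(_ _ (leqnn _))/= Hk] := near_infty_natSinv_lt (PosNum e20).
  by exists k.
have Q i : {q : rat | @ball R R (phi t 0 i) k.+1%:R^-1 (ratr q)}.
  have k0 : 0 < k.+1%:R^-1 :> R by rewrite invr_gt0.
  have lr : phi t 0 i - k.+1%:R^-1 < phi t 0 i + k.+1%:R^-1.
    by rewrite ltrD2l gtrN.
  apply: cid; have [q] := rat_in_itvoo lr.
  by rewrite in_itv/= => qk; exists q; rewrite /ball/= distrC ltr_distl.
exists (\row_i sval (Q i), k) => //; split.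
  by move=> i; rewrite mxE; case: (Q i) => q qb /=; exact: ball_sym.
move=> s Es; apply: eU; split => // i j; rewrite (ord1 i).
have := Es j; rewrite mxE; case: (Q j) => q /= qt qs.
apply: (@le_ball _ _ _ (k.+1%:R^-1 + k.+1%:R^-1)).
  by rewrite [e]splitr lerD// ltW.
exact: ball_triangle qt qs.
Qed.

End Measurability.

(** * An integrable weight on R^n *)

Section Integrability.
Context {R : realType}.

Lemma integral_oneDsqrV_lty :
  (\int[lebesgue_measure]_x ((oneDsqr x)^-1 : R)%:E < +oo)%E.
Proof.
rewrite ge0_symfun_integralT.
- by rewrite -set_itvcy integral0y_oneDsqr -EFinM ltry.
- by move=> x; rewrite invr_ge0.
- exact: continuous_oneDsqrV.
- by move=> x; rewrite /= /oneDsqr sqrrN.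
Qed.

Lemma measurable_oneDsqrV_prod n :
  measurable_fun setT (fun t : n.-tuple (measurableTypeR R) =>
    \prod_(i < n) (oneDsqr (tnth t i))^-1).
Proof.
apply: measurable_prod => i _.
apply: (@measurableT_comp _ _ _ _ _ _ (fun x : R => (oneDsqr x)^-1)); last exact: measurable_tnth.
apply: continuous_measurable_fun; exact: continuous_oneDsqrV.
Qed.

(** By Tonelli, splitting off the first coordinate splits off a factor
    [\int (1 + x^2)^-1 dx]. *)
Lemma integral_oneDsqrV_prod_lty n :
  (\int[lebesgue_tuple R n]_t (\prod_(i < n) (oneDsqr (tnth t i))^-1)%:E < +oo)%E.
Proof.
have mP k : measurable_fun setT (fun t : k.-tuple (measurableTypeR R) =>
    (\prod_(i < k) (oneDsqr (tnth t i))^-1)%:E).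
  by apply/measurable_EFinP; exact: measurable_oneDsqrV_prod.
elim: n => [|n IH].
  by rewrite /= integral_dirac//= ?diracT ?mul1e ?big_ord0 ?ltry//; exact: (mP 0).
rewrite /= /tuple_cons_measure ge0_integral_pushforward//; last 3 first.
- exact: measurable_tuple_cons.
- exact: (mP n.+1).
- by move=> t _; rewrite lee_fin prodr_ge0// => i _; rewrite invr_ge0.
rewrite preimage_setT fubini_tonelli1/=; last 2 first.
- exact: (measurableT_comp (mP n.+1) (@measurable_tuple_cons R n)).
- by move=> t; rewrite lee_fin prodr_ge0// => i _; rewrite invr_ge0.
set I := (\int[lebesgue_tuple R n]_t (\prod_(i < n) (oneDsqr (tnth t i))^-1)%:E)%E in IH.
have prod0 (t : n.-tuple (measurableTypeR R)) :
    (0 <= (\prod_(i < n) (oneDsqr (tnth t i))^-1)%:E)%E.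
  by rewrite lee_fin prodr_ge0// => i _; rewrite invr_ge0.
have I0 : (0 <= I)%E by exact: integral_ge0.
rewrite [X in (X < _)%E](_ : _ =
    (\int[lebesgue_measure]_x (I * ((oneDsqr x)^-1)%:E))%E); last first.
  apply: eq_integral => x _; rewrite /fubini_F /= muleC /I -ge0_integralZl//; last exact: (mP n).
  apply: eq_integral => t _; rewrite big_ord_recl /= tnth0 -EFinM; congr (_ * _)%:E.
  by apply: eq_bigr => i _; rewrite tnthS.
rewrite ge0_integralZl//; last first.
  by apply/measurable_EFinP; apply: continuous_measurable_fun; exact: continuous_oneDsqrV.
by rewrite lte_mul_pinfty// ?ge0_fin_numE//; exact: integral_oneDsqrV_lty.
Qed.

End Integrability.

(** * Decay of Schwartz functions *)

Section SchwartzDecay.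
Context {R : realType} {d : nat}.
Implicit Types (F : 'rV[R]_d -> R) (a : multiindex 'I_d).

Definition xpow (v : 'I_d -> R) (a : multiindex 'I_d) : R := \prod_i v i ^+ a i.

Lemma xpow_munitD (v : 'I_d -> R) a (i : 'I_d) : xpow v (a + munit i) = v i * xpow v a.
Proof.
rewrite /xpow (bigD1 i)//= [in RHS](bigD1 i)//= mulrA munitDE eqxx addn1 exprS.
by congr (_ * _); apply: eq_bigr => j /negbTE ji; rewrite munitDE ji addn0.
Qed.

Lemma schwartz_continuous F : schwartz_rV F -> continuous F.
Proof. by move=> [sF _]; have [] := sF [::]. Qed.

Lemma schwartz_bounded F a : schwartz_rV F ->
  exists M : R, forall v : 'rV[R]_d, `|xpow (v 0) a * F v| <= M.
Proof. by move=> [_ bF]; exact: (bF a [::]). Qed.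

(** Expanding [prod_i (1 + v_i^2) * v^a] gives finitely many monomials, each of
    which stays bounded after multiplication by [F]. *)
Lemma schwartz_decay F a : schwartz_rV F ->
  exists M : R, forall v : 'rV[R]_d,
    `|xpow (v 0) a * F v| <= M * \prod_i (oneDsqr (v 0 i))^-1.
Proof.
move=> sF.
have [M HM] : exists M : R, forall v : 'rV[R]_d,
    `|\prod_i oneDsqr (v 0 i) * (xpow (v 0) a * F v)| <= M.
  (* Each factor [1 + v_i^2] contributes the bounds for the exponents [a] and
     [a + 2 e_i]. *)
  elim: (index_enum _) a => [|i s IH] a.
    have [M HM] := schwartz_bounded a sF; exists M => v.
    by rewrite big_nil mul1r.
  have [M HM] := IH a; have [N HN] := IH (a + munit i + munit i).
  exists (M + N) => v; rewrite big_cons.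
  have := HN v; have := HM v; rewrite !xpow_munitD => HMv HNv.
  rewrite {1}/oneDsqr -mulrA mulrDl mul1r (le_trans (ler_normD _ _))// lerD//.
  by move: HNv; congr (`|_| <= _); rewrite expr2; ring.
exists M => v.
have P0 : 0 < \prod_i oneDsqr (v 0 i) 
  by apply: prodr_gt0 => i _; exact: lt_le_trans ltr01 (oneDsqr_ge1 _).
rewrite prodfV ler_pdivlMr// mulrC.
by have := HM v; rewrite normrM gtr0_norm.
Qed.

Local Notation T := (d.-tuple (measurableTypeR R)).

(** Boundedness is enough for the factor evaluated at [phi t]; the decay of the
    factor evaluated at [t] alone makes the product integrable. *)
Lemma integrable_schwartz_mul (mu := lebesgue_tuple R d) (c : {nonneg R})
    F H a b (phi : T -> 'rV[R]_d) :
  schwartz_rV F -> schwartz_rV H ->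
  (forall i, measurable_fun setT (fun t => phi t 0 i)) ->
  (mscale c mu).-integrable setT (EFin \o fun t : T =>
     (xpow (phi t 0) a * F (phi t)) * (xpow (tnth t) b * H (\row_i tnth t i))).
Proof.
move=> sF sH mphi.
have [M HM] := schwartz_bounded a sF; have [N HN] := schwartz_decay b sH.
have M0 : 0 <= M by exact: le_trans (HM 0).
pose w (t : T) := \prod_i (oneDsqr (tnth t i))^-1.
have w0 t : 0 <= w t by apply: prodr_ge0 => i _; rewrite invr_ge0.
have HNt (t : T) : `|xpow (tnth t) b * H (\row_i tnth t i)| <= N * w t.
  have := HN (\row_i tnth t i); rewrite /xpow /w.
  under eq_bigr do rewrite mxE; by under [in X in _ <= X]eq_bigr do rewrite mxE.
have mw := @measurable_oneDsqrV_prod R d.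
have iw : (mscale c mu).-integrable setT (EFin \o w).
  apply/integrableP; split; first exact/measurable_EFinP.
  rewrite (eq_integral (fun t => (w t)%:E)); last first.
    by move=> t _; rewrite /= ger0_norm.
  rewrite ge0_integral_mscale//; last 2 first.
  - exact/measurable_EFinP.
  - by move=> t _; rewrite lee_fin.
  by rewrite lte_mul_pinfty ?lee_fin//; exact: integral_oneDsqrV_prod_lty.
apply: (@le_integrable _ _ _ _ _ measurableT _ (EFin \o (fun t => M * N * w t))).
- apply/measurable_EFinP; apply: measurable_funM; apply: measurable_funM.
  + by apply: measurable_prod => i _; exact: measurable_funX.
  + exact: continuous_measurable_rV (schwartz_continuous sF) _.
  + by apply: measurable_prod => i _; apply: measurable_funX; exact: measurable_tnth.
  + apply: (@continuous_measurable_rV _ _ _ _ _ (fun t : T => \row_i tnth t i)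
      (schwartz_continuous sH)) => i.
    by under eq_fun do rewrite mxE; exact: measurable_tnth.
- move=> t _; rewrite /= lee_fin normrM -mulrA [leRHS]ger0_norm; last first.
    by rewrite mulr_ge0// (le_trans _ (HNt t)).
  exact: ler_pM.
- have := integrableZl measurableT (M * N) iw.
  by [].
Qed.
End SchwartzDecay.

(** * Integrals of complex functions on the group *)

Section LieIntegral.
Context {R : realType} {g : vectType R} {d : nat} (X : d.-tuple g) (c : {posnum R}).
Implicit Types f h : g -> R[i].

Local Notation mu := (mscale c%:num%:nng (lebesgue_tuple R d)).

Definition lie_integrable f : Prop :=
  mu.-integrable setT (EFin \o fun t => complex.Re (f (of_coords X (tnth t)))) /\
  mu.-integrable setT (EFin \o fun t => complex.Im (f (of_coords X (tnth t)))).

Lemma lie_integral0 : lie_integral X c (fun=> 0) = 0.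
Proof. by rewrite /lie_integral /= !Rintegral_cst// !mul0r. Qed.

Lemma lie_integrable0 : lie_integrable (fun=> 0).
Proof. by split; exact: integrable0. Qed.

Lemma lie_integrableZD (r : R) f h : lie_integrable f -> lie_integrable h ->
  lie_integrable (fun y => r%:C%C * f y + h y).
Proof.
move=> [fr fi] [hr hi]; split.
- apply: eq_integrable (integrableD measurableT (integrableZl measurableT r fr) hr) => //.
  move=> t _ /=; case: (f _) (h _) => [? ?] [? ?] /=.
  by rewrite -EFinM -EFinD mul0r subr0.
- apply: eq_integrable (integrableD measurableT (integrableZl measurableT r fi) hi) => //.
  move=> t _ /=; case: (f _) (h _) => [? ?] [? ?] /=.
  by rewrite -EFinM -EFinD mul0r addr0.
Qed.

Lemma lie_integralZD (r : R) f h : lie_integrable f -> lie_integrable h ->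
  lie_integral X c (fun y => r%:C%C * f y + h y) =
  r%:C%C * lie_integral X c f + lie_integral X c h.
Proof.
move=> [fr fi] [hr hi]; rewrite /lie_integral.
have Zr u : mu.-integrable setT (EFin \o u) ->
    mu.-integrable setT (EFin \o (fun t => r * u t)).
  by move=> iu; exact: (integrableZl measurableT r iu).
apply/eqP; rewrite eq_complex /= !mul0r subr0 addr0; apply/andP; split; apply/eqP.
- rewrite -RintegralZl// -RintegralD//; last exact: Zr.
  apply: eq_Rintegral => t _; case: (f _) (h _) => [? ?] [? ?] /=.
  by rewrite mul0r subr0.
- rewrite -RintegralZl// -RintegralD//; last exact: Zr.
  apply: eq_Rintegral => t _; case: (f _) (h _) => [? ?] [? ?] /=.
  by rewrite mul0r addr0.
Qed.

Lemma lie_integralZ (r : R) f : lie_integrable f ->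
  lie_integral X c (fun y => r%:C%C * f y) = r%:C%C * lie_integral X c f.
Proof.
move=> fI; have := lie_integralZD r fI lie_integrable0.
by rewrite lie_integral0 addr0 => <-; under [in RHS]eq_fun do rewrite addr0.
Qed.

Lemma lie_integral_sum (I : Type) (s : seq I) (r : I -> R) (F : I -> g -> R[i]) :
  (forall i, lie_integrable (F i)) ->
  lie_integral X c (fun y => \sum_(i <- s) (r i)%:C%C * F i y) =
  \sum_(i <- s) (r i)%:C%C * lie_integral X c (F i).
Proof.
move=> iF.
have iS s' : lie_integrable (fun y => \sum_(i <- s') (r i)%:C%C * F i y).
  elim: s' => [|i s' IH].
    by under eq_fun do rewrite big_nil; exact: lie_integrable0.
  by under eq_fun do rewrite big_cons; exact: lie_integrableZD.
elim: s => [|i s IH].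
  by under eq_fun do rewrite big_nil; rewrite big_nil lie_integral0.
by under eq_fun do rewrite big_cons; rewrite big_cons lie_integralZD// IH.
Qed.

Hypothesis hX : basis_of fullv X.

(** The coordinates of [x o y^-1] are affine in those of [y], hence measurable; the
    real and imaginary parts of the product are combinations of the four products
    of a part of [f] and a part of [h]. *)
Lemma lie_integrable_conv (br : {bilinear g -> g -> g}) f h a b x :
  schwartz X f -> schwartz X h ->
  lie_integrable (fun y => Tmul X a f (lie_mul br x (lie_inv y)) * Tmul X b h y).
Proof.
move=> [fr fi] [hr hi].
pose phi (t : d.-tuple (measurableTypeR R)) : 'rV[R]_d :=
  \row_i coord X i (lie_mul br x (lie_inv (of_coords X (tnth t)))).
have mphi i : measurable_fun setT (fun t => phi t 0 i).
  pose L j := - (coord X i (tnth X j) + 2^-1 * coord X i (br x (tnth X j))).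
  rewrite (_ : (fun t => _) = fun t => coord X i x + \sum_j tnth t j * L j).
    apply: measurable_funD => //; apply: measurable_sum => j.
    by apply: measurable_funM => //; exact: measurable_tnth.
  apply/funext => t; rewrite mxE /lie_mul /lie_inv -addrA linearD; congr (_ + _).
  rewrite linearNr scalerN -opprD linearN linearD linearZ /= /of_coords.
  rewrite linear_sumr !linear_sum /= mulr_sumr -big_split /= -sumrN.
  apply: eq_bigr => j _; rewrite linearZr_LR /L !linearZ /=.
  by ring.
have of_phi t : of_coords X (phi t 0) = lie_mul br x (lie_inv (of_coords X (tnth t))).
  rewrite -[RHS](coordK hX); congr of_coords; apply/funext => i.
  by rewrite mxE.
have mono_phi t :
    monomial X a (lie_mul br x (lie_inv (of_coords X (tnth t)))) = xpow (phi t 0) a.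
  by apply: eq_bigr => i _; rewrite mxE.
have mono_t (t : d.-tuple (measurableTypeR R)) :
    monomial X b (of_coords X (tnth t)) = xpow (tnth t) b.
  by apply: eq_bigr => i _; rewrite of_coordsK.
have row_t (t : d.-tuple (measurableTypeR R)) :
    of_coords X ((\row_i tnth t i : 'rV[R]_d) 0) = of_coords X (tnth t).
  by congr of_coords; apply/funext => i; rewrite mxE.
have I F H (sF : schwartz_rV F) (sH : schwartz_rV H) e :=
  integrable_schwartz_mul e a b sF sH mphi.
split.
- apply: eq_integrable (integrableB measurableT (I _ _ fr hr _) (I _ _ fi hi _)) => //.
  move=> t _; rewrite /= -EFinB of_phi row_t /Tmul mono_phi mono_t.
  case: (f _) (h _) => [? ?] [? ?] /=; congr EFin; ring.
- apply: eq_integrable (integrableD measurableT (I _ _ fr hi _) (I _ _ fi hr _)) => //.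
  move=> t _; rewrite /= -EFinD of_phi row_t /Tmul mono_phi mono_t.
  case: (f _) (h _) => [? ?] [? ?] /=; congr EFin; ring.
Qed.

End LieIntegral.

(** * Monomial multiples of a convolution *)

Theorem theorem1p7 (R : realType) (d : nat) (g : vectType R)
    (br : {bilinear g -> g -> g}) (delta : R -> 'End(g))
    (X : d.-tuple g) (c : {posnum R})
    (hlie : lie_bracket br) (hstep : two_step br)
    (hdil : dilations br delta) (hgrad : graded12 delta)
    (hX : basis_of fullv X)
    (f h : g -> R[i]) (hf : schwartz X f) (hh : schwartz X h)
    (alpha : multiindex 'I_d) :
  (forall s : multiindex (struct_dom br X), sigma_const s != 0) /\
  forall x : g,
    Tmul X alpha (lie_conv X br c f h) x =
    \sum_(u \in sigma_decomp br X alpha)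
      (sigma_binom alpha u.1.1 u.2 * sigma_const u.2)%:C%C *
      lie_conv X br c (Tmul X (u.1.1 + sigma1 u.2) f)
                  (Tmul X (u.1.2 + sigma2 u.2) h) x.
Proof.
split=> [s|x].
  rewrite /sigma_const mulf_neq0 ?invr_neq0 ?expf_neq0 ?pnatr_eq0//.
  by apply/prodf_neq0 => t _; rewrite expf_neq0//; exact: (valP t).
have fA := @finite_sigma_decomp R g br d X alpha.
pose K a b (y : g) := Tmul X a f (lie_mul br x (lie_inv y)) * Tmul X b h y.
have iK a b : lie_integrable X c (K a b) by exact: lie_integrable_conv.
rewrite fsbig_finite//.
rewrite -(lie_integral_sum _ _ (fun u => iK (u.1.1 + sigma1 u.2) (u.1.2 + sigma2 u.2))).
have T0 f' : Tmul X 0 f' = f'.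
  apply/funext => y; rewrite /Tmul /monomial big1 ?mul1r// => i _.
  by rewrite ffunE expr0.
(* The convolution [f * h] itself is the term [K 0 0]. *)
have i00 : lie_integrable X c (fun y => f (lie_mul br x (lie_inv y)) * h y).
  by have := iK 0 0; rewrite /K !T0.
rewrite {1}/Tmul /lie_conv -lie_integralZ//; congr lie_integral; apply/funext => y.
rewrite -{1}(lie_mul_invK x y hlie hstep) monomial_lie_mul// fsbig_finite//.
rewrite (raddf_sum (real_complex R)) /= mulr_suml. apply: eq_bigr => u _.
by rewrite /K /Tmul !rmorphM /=; ring.
Qed.
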